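(* Let $t\in\{1,\dots,T\}$ and let $f_t:\mathbb{R}^d\to\mathbb{R}$ be a convex, $L_t$-smooth function with $L_t>0$. Define the discretized gradient step with step size $h_t$ by $$x_{t+\frac12}=x_t-h_t\nabla_x f_t(x_t).$$ Consider two trajectories whose values at time $t$ are $x_t,z_t\in\mathbb{R}^d$, and let $x_{t+\frac12}$ and $z_{t+\frac12}=z_t-h_t\nabla_x f_t(z_t)$ be the results of this step. If $0\le h_t\le\frac{2}{L_t}$, then $$\lVert x_{t+\frac12}-z_{t+\frac12}\rVert_2\le\lVert x_t-z_t\rVert_2.$$
   Context: A function $f:\mathbb{R}^d\to\mathbb{R}$ is $L$-smooth if it is differentiable and $x\mapsto\nabla_x f(x)$ is $L$-Lipschitz for the Euclidean norm $\lVert\cdot\rVert_2$. The points $x_t,z_t$ are arbitrary points of $\mathbb{R}^d$. *)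

(* Defs.v *)
From HB Require Import structures.
From mathcomp Require Import all_boot all_order all_algebra.
From mathcomp Require Import all_classical all_reals all_analysis.

Set Implicit Arguments.
Unset Strict Implicit.
Unset Printing Implicit Defensive.

Import Order.TTheory GRing.Theory Num.Theory.
Import numFieldNormedType.Exports.

Local Open Scope ring_scope.

(* The library norm `|x| on 'rV[R]_d is the sup norm. It is used below only
   through differentiability, which does not depend on the choice of norm. *)
Definition norm2 (R : realType) (d : nat) (x : 'rV[R]_d) : R :=
  Num.sqrt (\sum_(i < d) x 0 i ^+ 2).

(* Where f is differentiable, 'd f x v = \sum_i gradient f x 0 i * v 0 i. *)
Definition gradient (R : realType) (d : nat) (f : 'rV[R]_d -> R)
    (x : 'rV[R]_d) : 'rV[R]_d :=
  \row_(i < d) 'D_(delta_mx 0 i) f x.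

Definition smooth (R : realType) (d : nat) (L : R) (f : 'rV[R]_d -> R) : Prop :=
  (forall x, differentiable f x) /\
  (forall x y, norm2 (gradient f x - gradient f y) <= L * norm2 (x - y)).

Definition gradient_step (R : realType) (d : nat) (h : R) (f : 'rV[R]_d -> R)
    (x : 'rV[R]_d) : 'rV[R]_d :=
  x - h *: gradient f x.

(* Main.v *)
(* Convexity places the graph of f above its tangent hyperplanes, and
   L-smoothness places it below the paraboloid of curvature L at any point y.
   Comparing the tangent hyperplane at x with the paraboloid at y, at the
   minimizer y - (g y - g x) / L of their difference, gives the bound
   |g x - g y|^2 <= L <g x - g y, x - y> on the gradient g (Baillon-Haddad), and
   then |x - y - h (g x - g y)|^2 <= |x - y|^2 follows by expanding the square. *)
Require Import Defs.
From HB Require Import structures.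
From mathcomp Require Import all_boot all_order all_algebra.
From mathcomp Require Import all_classical all_reals all_analysis.
From mathcomp Require Import ring lra.

Set Implicit Arguments.
Unset Strict Implicit.
Unset Printing Implicit Defensive.

Import Order.TTheory GRing.Theory Num.Theory.
Import numFieldNormedType.Exports.

Local Open Scope classical_set_scope.
Local Open Scope ring_scope.

(** A scalar sum rather than a matrix product, so that [norm2 u] is the square root of [dot u u] by
    conversion. *)
Definition dot (R : pzSemiRingType) (d : nat) (u v : 'rV[R]_d) : R :=
  \sum_(i < d) u 0 i * v 0 i.

Section DotProduct.
Variables (R : comPzRingType) (d : nat).
Implicit Types (u v w : 'rV[R]_d) (a : R).

Lemma dotC u v : dot u v = dot v u.
Proof. by apply: eq_bigr => i _; rewrite mulrC. Qed.

Lemma dotDl u v w : dot (u + v) w = dot u w + dot v w.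
Proof. by rewrite -big_split; apply: eq_bigr => i _; rewrite mxE mulrDl. Qed.

Lemma dotZl a u v : dot (a *: u) v = a * dot u v.
Proof. by rewrite mulr_sumr; apply: eq_bigr => i _; rewrite mxE mulrA. Qed.

Lemma dotNl u v : dot (- u) v = - dot u v.
Proof. by rewrite -scaleN1r dotZl mulN1r. Qed.

Lemma dotBl u v w : dot (u - v) w = dot u w - dot v w.
Proof. by rewrite dotDl dotNl. Qed.

Lemma dotDr u v w : dot w (u + v) = dot w u + dot w v.
Proof. by rewrite !(dotC w) dotDl. Qed.

Lemma dotZr a u v : dot u (a *: v) = a * dot u v.
Proof. by rewrite !(dotC u) dotZl. Qed.

Lemma dotNr u v : dot u (- v) = - dot u v.
Proof. by rewrite !(dotC u) dotNl. Qed.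

Lemma dotBr u v w : dot w (u - v) = dot w u - dot w v.
Proof. by rewrite !(dotC w) dotBl. Qed.

End DotProduct.

Section Gradient.
Variables (R : realType) (d : nat).
Implicit Types (f : 'rV[R]_d -> R) (u v x y : 'rV[R]_d) (L h : R).

Lemma norm2_ge0 u : 0 <= norm2 u.
Proof. exact: sqrtr_ge0. Qed.

Lemma dot_ge0 u : 0 <= dot u u.
Proof. by apply: sumr_ge0 => i _; rewrite -expr2 sqr_ge0. Qed.

Lemma norm2E u : norm2 u = Num.sqrt (dot u u).
Proof. by []. Qed.

Lemma sqr_norm2 u : norm2 u ^+ 2 = dot u u.
Proof. by rewrite norm2E sqr_sqrtr ?dot_ge0. Qed.

(* Expanding 0 <= |u - c v|^2 avoids the case |v| = 0 of Cauchy-Schwarz. *)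
Lemma dot_le_of_norm2_le c u v :
  0 < c -> norm2 u <= c * norm2 v -> dot u v <= c * dot v v.
Proof.
move=> c_gt0 le_uv.
have : dot u u <= c ^+ 2 * dot v v.
  rewrite -!sqr_norm2 -exprMn ler_sqr ?nnegrE ?norm2_ge0 //.
  by rewrite mulr_ge0 ?norm2_ge0 // ltW.
have := dot_ge0 (u - c *: v).
rewrite !(dotBl, dotBr, dotZl, dotZr) (dotC v u) => sq_ge0 le_uu.
rewrite -(ler_pM2l c_gt0); nra.
Qed.

(** The difference quotient at [s] along the line is that of [f] at [x + s *: v] in direction [v];
    linearity of the differential then expands [v] over the standard basis. *)
Lemma is_derive_line f (f_diff : forall x, differentiable f x) x v (s : R) :
  is_derive s 1 (fun r : R => f (x + r *: v))
    (dot (gradient f (x + s *: v)) v).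
Proof.
set a := x + s *: v.
have quotE : (fun h => h^-1 *: (f (x + (h *: (1 : R) + s) *: v) - f a)) =
    (fun h => h^-1 *: (f (h *: v + a) - f a)).
  by apply/funext => h; rewrite /a scaler1 scalerDl addrCA.
apply: DeriveDef.
  by rewrite /derivable /= quotE; apply: diff_derivable.
rewrite /derive /= quotE -/(derive f a v) deriveE // [in LHS](row_sum_delta v).
rewrite linear_sum; apply: eq_bigr => i _.
by rewrite linearZ /= mxE deriveE // mulrC.
Qed.

(** By convexity, (f (x + h (y - x)) - f x) / h is at most f y - f x for 0 < h <= 1; letting h tend
    to 0 from the right gives the bound. *)
Lemma convex_gradient_le f :
  convex_function [set: convex_lmodType 'rV[R]_d] f ->
  (forall x, differentiable f x) ->
  forall x y, f x + dot (gradient f x) (y - x) <= f y.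
Proof.
move=> f_convex f_diff x y.
have [dble dE] := is_derive_line f_diff x (y - x) 0.
rewrite scale0r addr0 in dE; rewrite -lerBrDl -dE.
apply: (cvgr_to_le (cvg_dnbhs_at_right dble)).
near=> h.
have h_gt0 : 0 < h by near: h; exact: nbhs_right_gt.
have h_le1 : h <= 1 by near: h; apply: nbhs_right_le.
have h_ge0 := ltW h_gt0.
have := f_convex (Itv01 h_ge0 h_le1) y x (in_setT _) (in_setT _).
rewrite convRE /= /unstable.onem => cvx.
rewrite /= scaler1 addr0 scale0r addr0 ler_pdivrMl //.
have -> : x + h *: (y - x) = h *: y + (1 - h) *: x.
  by rewrite scalerBr scalerBl scale1r addrCA addrA.
by rewrite lerBlDr (le_trans cvx) // le_eqVlt; apply/orP; left; apply/eqP; ring.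
Unshelve. all: by end_near. Qed.

(** On the segment from [x] to [y], [phi] is [f] minus the non-constant part of the paraboloid. The
    Lipschitz bound makes its derivative nonpositive, and the claim is [phi 1 <= phi 0]. *)
Lemma smooth_le f L : 0 < L -> smooth L f -> forall x y,
  f y <= f x + dot (gradient f x) (y - x) + L / 2 * dot (y - x) (y - x).
Proof.
move=> L_gt0 [f_diff f_lip] x y.
set v := y - x; set g := dot (gradient f x) v; set n := dot v v.
pose phi (s : R) := f (x + s *: v) - (s * g + L / 2 * n * s ^+ 2).
have phi_derive (s : R) : is_derive s 1 phi
    (dot (gradient f (x + s *: v)) v - (g + L * n * s)).
  have line_derive := is_derive_line f_diff x v s.
  by apply: is_derive_eq; rewrite /GRing.scale /=; field.
have : phi 1 <= phi 0.
  apply: (ler0_derive1_le_cc (f := phi) (a := 0) (b := 1));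
    rewrite ?in_itv /= ?ler01 ?lexx //.
  - move=> s; rewrite in_itv /= => /andP[s_gt0 _].
    rewrite derive1E derive_val opprD addrA -dotBl subr_le0 mulrAC.
    (* Used with c = L s, positive because [s] is interior to [0, 1]. *)
    apply: dot_le_of_norm2_le; first by rewrite mulr_gt0.
    apply: le_trans (f_lip _ _) _.
    rewrite [x + _]addrC addrK [norm2 (s *: v)]norm2E dotZl dotZr mulrA.
    by rewrite sqrtrM -?expr2 ?sqr_ge0 // sqrtr_sqr gtr0_norm // mulrA.
  - by apply/derivable_within_continuous => s _; case: (phi_derive s).
by rewrite /phi scale1r scale0r addr0 /v [x + _]addrC subrK; lra.
Qed.

Lemma smooth_convex_le f L :
  0 < L -> convex_function [set: convex_lmodType 'rV[R]_d] f -> smooth L f ->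
  forall x y, let g := gradient f y - gradient f x in
  f x + dot (gradient f x) (y - x) + (2 * L)^-1 * dot g g <= f y.
Proof.
move=> L_gt0 f_convex f_smooth x y /=; set g := gradient f y - gradient f x.
pose w := y - L^-1 *: g.
have := convex_gradient_le f_convex f_smooth.1 x w.
have := smooth_le L_gt0 f_smooth y w.
have -> : w - y = (- L^-1) *: g by rewrite /w addrC addKr scaleNr.
have -> : w - x = (y - x) - L^-1 *: g by rewrite /w addrAC.
have -> : gradient f y = gradient f x + g by rewrite /g addrCA subrr addr0.
clearbody g; rewrite !(dotDl, dotBr, dotZr, dotZl).
(* The linear terms gain |g|^2 / L and the quadratic one costs |g|^2 / (2 L). Writing all
   coefficients through [(2 * L)^-1] makes the rest linear arithmetic. *)
have -> : L / 2 * (- L^-1 * (- L^-1 * dot g g)) = (2 * L)^-1 * dot g g.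
  by field; rewrite gt_eqF.
have -> : L^-1 = 2 * (2 * L)^-1 by field; rewrite gt_eqF.
lra.
Qed.

(** Adding the previous bound to itself with [x] and [y] exchanged cancels the values of [f]. *)
Lemma gradient_cocoercive f L :
  0 < L -> convex_function [set: convex_lmodType 'rV[R]_d] f -> smooth L f ->
  forall x y, let g := gradient f x - gradient f y in
  dot g g <= L * dot g (x - y).
Proof.
move=> L_gt0 f_convex f_smooth x y /=; set g := gradient f x - gradient f y.
have := smooth_convex_le L_gt0 f_convex f_smooth x y.
have := smooth_convex_le L_gt0 f_convex f_smooth y x.
rewrite /= -/g -[gradient f y - gradient f x]opprB -/g -[y - x]opprB.
have -> : gradient f x = gradient f y + g by rewrite /g addrCA subrr addr0.
clearbody g; rewrite !(dotNl, dotNr, dotDl) => le_xy le_yx.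
rewrite -ler_pdivrMl //.
have -> : L^-1 = 2 * (2 * L)^-1 by field; rewrite gt_eqF.
lra.
Qed.

Lemma gradient_step_nonexpansive f L h :
  0 < L -> convex_function [set: convex_lmodType 'rV[R]_d] f -> smooth L f ->
  0 <= h <= 2 / L ->
  forall x y, norm2 (gradient_step h f x - gradient_step h f y) <= norm2 (x - y).
Proof.
move=> L_gt0 f_convex f_smooth /andP[h_ge0 h_le] x y.
have := gradient_cocoercive L_gt0 f_convex f_smooth x y.
set g := gradient f x - gradient f y => /= cocoercive.
have -> : gradient_step h f x - gradient_step h f y = (x - y) - h *: g.
  by rewrite /gradient_step /g scalerBr !opprB addrACA [RHS]addrACA [- y - _]addrC.
clearbody g; rewrite !norm2E; apply: ler_wsqrtr.
rewrite (dotBl (x - y)) !(dotBr (x - y)) !(dotZl, dotZr) (dotC _ g).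
have hL_le2 : h * L <= 2 by rewrite -ler_pdivlMr.
(* After multiplying by L: h L |g|^2 <= 2 |g|^2 by the step-size bound, and |g|^2 <= L <g, x - y> by
   cocoercivity. *)
have : h * dot g g <= 2 * dot g (x - y).
  rewrite -(ler_pM2l L_gt0); have := dot_ge0 g; nra.
(* A further factor h bounds h^2 |g|^2 by the cross term 2 h <g, x - y> of the expanded square. *)
move=> /(ler_wpM2l h_ge0); lra.
Qed.

End Gradient.

Theorem proposition3 (R : realType) (d T t : nat) (ht : (1 <= t <= T)%N)
    (f : nat -> 'rV[R]_d -> R) (L h : nat -> R) (x z : nat -> 'rV[R]_d)
    (L_gt0 : 0 < L t)
    (f_convex : convex_function [set: convex_lmodType 'rV[R]_d] (f t))
    (f_smooth : smooth (L t) (f t))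
    (h_bounds : 0 <= h t <= 2 / L t) :
  norm2 (gradient_step (h t) (f t) (x t) - gradient_step (h t) (f t) (z t))
    <= norm2 (x t - z t).
Proof. exact: gradient_step_nonexpansive L_gt0 f_convex f_smooth h_bounds _ _. Qed.
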